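(* Let $G$ be a finite simple non-trivial graph with maximum degree $\Delta$ and minimum degree $\delta$. Then $$GA_1(\mathcal{L}(G))\ge \min\Big\{\frac{3}{4\sqrt{2}},\ \frac{2\sqrt{(2\Delta-2)\max\{2\delta-2,1\}}}{2\Delta-2+\max\{2\delta-2,1\}}\Big\}\,GA_1(G).$$ Moreover, the equality is attained for the path graph $P_3$ with three vertices.
   Context: A graph is non-trivial if each of its connected components has at least two edges. For a finite simple graph $H$, with $d_u$ the degree of the vertex $u$ in $H$, the first geometric-arithmetic index is $GA_1(H)=\sum_{uv\in E(H)}\frac{2\sqrt{d_u d_v}}{d_u+d_v}$ (each edge counted once). The line graph $\mathcal{L}(G)$ has the edges of $G$ as vertices, two distinct ones being adjacent if and only if they share an endpoint in $G$. *)

(* Defs.v *)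
From mathcomp Require Import all_boot all_order all_algebra.
Set Implicit Arguments.
Unset Strict Implicit.
Unset Printing Implicit Defensive.
Import Order.TTheory GRing.Theory Num.Theory.
Local Open Scope ring_scope.

Record sgraph := SGraph {
  vertex :> finType;
  adj : rel vertex;
  adj_sym : symmetric adj;
  adj_irr : irreflexive adj
}.

Definition edges (G : sgraph) : {set {set G}} :=
  [set [set x; y] | x in [set: G], y in adj x].

Definition degree (G : sgraph) (x : G) : nat := #|[set y : G | adj x y]|.

Definition max_degree (G : sgraph) : nat := (\max_(x : G) degree x)%N.

(* Every degree is at most #|G|, so the default value of the iterated minimum
   is irrelevant as soon as G has a vertex. *)
Definition min_degree (G : sgraph) : nat := \big[minn/#|G|]_(x : G) degree x.

Definition component (G : sgraph) (x : G) : {set G} :=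
  [set y | connect (@adj G) x y].

Definition nontrivial (G : sgraph) : Prop :=
  forall x : G, (2 <= #|[set e in edges G | e \subset component x]|)%N.

(* An edge is a two-element set {u, v}, so the product and the sum over its
   elements are d_u * d_v and d_u + d_v. *)
Definition GA1 (R : rcfType) (G : sgraph) : R :=
  \sum_(e in edges G)
    2 * Num.sqrt (\prod_(u in e) (degree u)%:R) / \sum_(u in e) (degree u)%:R.

Section LineGraph.
Variable G : sgraph.

Definition line_vertex : finType := {e : {set G} | e \in edges G}.

Definition line_adj : rel line_vertex :=
  fun e f => (e != f) && (val e :&: val f != set0).

Fact line_adj_sym : symmetric line_adj.
Proof. by move=> e f; rewrite /line_adj eq_sym setIC. Qed.

Fact line_adj_irr : irreflexive line_adj.
Proof. by move=> e; rewrite /line_adj eqxx. Qed.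

Definition line_graph : sgraph := SGraph line_adj_sym line_adj_irr.
End LineGraph.

Section PathGraph.
Variable n : nat.

Definition path_adj : rel 'I_n :=
  fun i j => (i.+1 == j :> nat) || (j.+1 == i :> nat).

Fact path_adj_sym : symmetric path_adj.
Proof. by move=> i j; rewrite /path_adj orbC. Qed.

Fact path_adj_irr : irreflexive path_adj.
Proof. by move=> i; rewrite /path_adj orbb gtn_eqF. Qed.

Definition path_graph : sgraph := SGraph path_adj_sym path_adj_irr.
End PathGraph.

Definition line_bound (R : rcfType) (Delta delta : R) : R :=
  let a := 2 * Delta - 2 in
  let b := Num.max (2 * delta - 2) 1 in
  Num.min (3 / (4 * Num.sqrt 2)) (2 * Num.sqrt (a * b) / (a + b)).

(* Main.v *)
(** Charging argument on the line graph. Write [k] for the constant and let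
    every edge [ef] of L(G) split its weight between its endpoints [e] and [f],
    so that each edge [e] of G receives at least [k] times its weight in G.
    The degrees of L(G) lie between [b = max (2 delta - 2) 1] and
    [a = 2 Delta - 2], so every edge of L(G) weighs at least
    [2 sqrt (a b) / (a + b) >= k]; half of that from each neighbour suffices
    for an [e] with two or more neighbours in L(G).
    An [e] with a single neighbour [f] joins vertices of degrees 1 and 2 and
    weighs [2 sqrt 2 / 3]; since [k <= 3 / (4 sqrt 2)], it needs only 1/2.
    If [f] has degree at most 2 in L(G), then [ef] weighs 1 or [2 sqrt 2 / 3],
    which is enough to give 1/2 to [e] and the usual share to [f].
    If [f] has degree at least 3, it leaves all of [ef] to [e]: one endpoint of
    [f] has degree at least 3 in G, and the at least two other edges there,
    none of which has degree 1 in L(G), pay for [f]. *)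

Require Import Defs.
From mathcomp Require Import all_boot all_order all_algebra.
From mathcomp Require Import ring lra zify.
Import Order.TTheory GRing.Theory Num.Theory.
Local Open Scope ring_scope.

(** * Double counting over ordered adjacent pairs *)

Section Handshake.
Set Implicit Arguments.
Unset Strict Implicit.
Variable G : sgraph.
Implicit Types x y : G.

Lemma edgesP (e : {set G}) :
  reflect (exists x y, adj x y /\ e = [set x; y]) (e \in edges G).
Proof.
apply: (iffP imset2P) => [[x y _ /= xy ->]|[x [y [xy ->]]]].
  by exists x, y.
by exists x y.
Qed.

Lemma adj_neq x y : adj x y -> x != y.
Proof. by apply: contraTneq => ->; rewrite adj_irr. Qed.

Lemma set2_eqE x y a b : adj x y ->
  ([set a; b] == [set x; y]) = ((a, b) == (x, y)) || ((a, b) == (y, x)).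
Proof.
move=> /adj_neq xy; rewrite !xpair_eqE.
apply/eqP/idP => [E|/orP[]/andP[/eqP-> /eqP->] //]; last exact: setUC.
have ax : a \in [set x; y] by rewrite -E set21.
have bx : b \in [set x; y] by rewrite -E set22.
have xa : x \in [set a; b] by rewrite E set21.
have ya : y \in [set a; b] by rewrite E set22.
move: ax bx xa ya xy; rewrite !inE.
move=> /orP[]/eqP-> /orP[]/eqP->; rewrite ?eqxx ?orbT //.
  by rewrite orbb => _ /eqP->; rewrite eqxx.
by rewrite orbb => /eqP->; rewrite eqxx.
Qed.

(** Each edge arises from exactly two ordered pairs, [(x, y)] and [(y, x)]. *)
Lemma sum_edges (V : nmodType) (F : {set G} -> V) :
  \sum_x \sum_(y | adj x y) F [set x; y] = (\sum_(e in edges G) F e) *+ 2.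
Proof.
rewrite pair_big_dep /=.
rewrite (partition_big (fun p : G * G => [set p.1; p.2]) (mem (edges G))) /=;
  last by move=> [x y] /= xy; apply/edgesP; exists x, y.
rewrite -sumrMnl; apply: eq_bigr => e /edgesP[x [y [xy ->]]].
rewrite (eq_bigl (fun p => p \in [set (x, y); (y, x)])); last first.
  move=> [a b] /=; rewrite set2_eqE // !inE.
  by case: orP => [[]/eqP[-> ->]|]; rewrite ?andbF ?andbT ?[adj y x]adj_sym ?xy.
rewrite big_setU1 ?big_set1 /= ?[in F [set y; x]]setUC //.
by rewrite inE xpair_eqE negb_and (adj_neq xy).
Qed.

(** Reversing pairs preserves adjacency. The charging argument uses this to split an edge weight
    between the two ends. *)
Lemma sum_adj_symmetrize (V : nmodType) (h : G -> G -> V) :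
  \sum_x \sum_(y | adj x y) (h x y + h y x) =
  (\sum_x \sum_(y | adj x y) h x y) *+ 2.
Proof.
under eq_bigr do rewrite big_split.
rewrite big_split mulr2n; congr (_ + _).
rewrite /= (exchange_big_dep xpredT) //=.
by apply: eq_bigr => y _; apply: eq_bigl => x; rewrite adj_sym.
Qed.

Lemma degree_gt0 x y : adj x y -> (0 < degree x)%N.
Proof. by move=> xy; apply/card_gt0P; exists y; rewrite inE. Qed.

Lemma degree_le_max x : (degree x <= max_degree G)%N.
Proof. exact: leq_bigmax. Qed.

Lemma min_degree_le x : (min_degree G <= degree x)%N.
Proof.
rewrite /min_degree; have := mem_index_enum x.
elim: (index_enum _) => // y s IHs; rewrite inE big_cons geq_min.
by case/orP => [/eqP->|/IHs->]; rewrite ?leqnn ?orbT.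
Qed.

End Handshake.

(** * The weight of an edge as a function of its end degrees *)

Definition ga (R : rcfType) (p q : nat) : R :=
  2 * Num.sqrt (p%:R * q%:R) / (p%:R + q%:R).

Lemma gaC (R : rcfType) p q : ga R p q = ga R q p.
Proof. by rewrite /ga mulrC addrC [X in Num.sqrt X]mulrC mulrC. Qed.

Section GAIndex.
Set Implicit Arguments.
Unset Strict Implicit.
Variable R : rcfType.

Definition ga_edge (G : sgraph) (e : {set G}) : R :=
  2 * Num.sqrt (\prod_(u in e) (degree u)%:R) / \sum_(u in e) (degree u)%:R.

Lemma ga_edge_set2 (G : sgraph) (x y : G) : adj x y ->
  ga_edge [set x; y] = ga R (degree x) (degree y).
Proof.
move=> xy; rewrite /ga_edge !big_setU1 ?big_set1 ?inE //; exact: adj_neq.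
Qed.

Lemma GA1_sum_adj (G : sgraph) :
  GA1 R G *+ 2 = \sum_(x : G) \sum_(y | adj x y) ga R (degree x) (degree y).
Proof.
rewrite -[GA1 R G]/(\sum_(e in edges G) ga_edge e) -sum_edges.
by apply: eq_bigr => x _; apply: eq_bigr => y; apply: ga_edge_set2.
Qed.

Lemma ga_le1 p q : ga R p q <= 1.
Proof.
(* Set apart because [p + q] may vanish; the rest is AM-GM, squared. *)
have [->|p0] := posnP p; first by rewrite /ga mul0r sqrtr0 mulr0 mul0r ler01.
have s0 : 0 < p%:R + q%:R :> R by rewrite ltr_wpDr ?ler0n ?ltr0n.
rewrite /ga ler_pdivrMr // mul1r.
rewrite -(@ler_pXn2r _ 2) ?nnegrE ?mulr_ge0 ?sqrtr_ge0 ?(ltW s0) //.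
rewrite exprMn sqr_sqrtr ?mulr_ge0 ?ler0n //.
have := sqr_ge0 (p%:R - q%:R : R); lra.
Qed.

Lemma ga11 : ga R 1 1 = 1.
Proof. by rewrite /ga mulr1 sqrtr1 mulr1 divff // pnatr_eq0. Qed.

Lemma ga12 : ga R 1 2 = 2 * Num.sqrt 2 / 3.
Proof. by rewrite /ga mul1r -(natrD _ 1 2). Qed.

Lemma sqrt2_gt : 4 / 3 < Num.sqrt 2 :> R.
Proof.
by rewrite -(@ltr_pXn2r _ 2) ?nnegrE ?sqrtr_ge0 ?sqr_sqrtr ?ler0n //; lra.
Qed.

Lemma sqrt2_lt : Num.sqrt 2 < 3 / 2 :> R.
Proof.
by rewrite -(@ltr_pXn2r _ 2) ?nnegrE ?sqrtr_ge0 ?sqr_sqrtr ?ler0n //; lra.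
Qed.

(** Rationalised form, linear in [Num.sqrt 2] as [lra] requires. *)
Lemma sqrt2_inv : 3 / (4 * Num.sqrt 2) = 3 / 8 * Num.sqrt 2 :> R.
Proof.
have r0 : Num.sqrt 2 != 0 :> R by rewrite gt_eqF // sqrtr_gt0 ltr0n.
have r2 : Num.sqrt 2 * Num.sqrt 2 = 2 :> R by rewrite -expr2 sqr_sqrtr ?ler0n.
apply: (mulIf r0); rewrite -[RHS]mulrA r2; field => //.
Qed.

(* [p q (a+b)^2 - a b (p+q)^2 = (p a - q b) (q a - p b)] *)
Lemma ga_ge (a b : R) p q : 0 < b -> b <= p%:R <= a -> b <= q%:R <= a ->
  2 * Num.sqrt (a * b) / (a + b) <= ga R p q.
Proof.
move=> b0 /andP[bp pa] /andP[bq qa]; rewrite /ga.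
set P := p%:R in bp pa *; set Q := q%:R in bq qa *.
have P0 := lt_le_trans b0 bp; have Q0 := lt_le_trans b0 bq.
have a0 := lt_le_trans P0 pa.
rewrite ler_pdivrMr ?addr_gt0 // mulrAC ler_pdivlMr ?addr_gt0 //.
rewrite -!mulrA ler_pM2l ?ltr0n //.
rewrite -(@ler_pXn2r _ 2) ?nnegrE ?mulr_ge0 ?sqrtr_ge0 ?addr_ge0 ?(ltW a0)
  ?(ltW b0) ?(ltW P0) ?(ltW Q0) //.
rewrite !exprMn !sqr_sqrtr ?mulr_ge0 ?(ltW a0) ?(ltW b0) ?(ltW P0) ?(ltW Q0) //.
have h1 : 0 <= P * a - Q * b.
  by rewrite subr_ge0 [P * a]mulrC ler_pM // ltW.
have h2 : 0 <= Q * a - P * b.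
  by rewrite subr_ge0 [Q * a]mulrC ler_pM // ltW.
have := mulr_ge0 h1 h2; lra.
Qed.

End GAIndex.

(** * Degrees in the line graph *)

Section LineDegree.
Set Implicit Arguments.
Unset Strict Implicit.
Variable G : sgraph.
Local Notation L := (line_graph G).

Definition incident (x : G) : {set L} := [set e : L | x \in val e].

(** The map [y |-> [set x; y]] is a bijection from the neighbours of [x] to the edges at [x]. *)
Lemma card_incident x : #|incident x| = degree x.
Proof.
have edge_xy y : adj x y -> [set x; y] \in edges G.
  by move=> xy; apply/edgesP; exists x, y.
rewrite /degree -(card_in_imset (f := fun y => [set x; y])); last first.
  move=> y z; rewrite !inE => xy xz /eqP; rewrite set2_eqE //.
  by case/orP => /eqP[] // E _; move: xz; rewrite E adj_irr.
rewrite -(card_imset _ val_inj); congr #|pred_of_set _|; apply/setP => e.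
apply/imsetP/imsetP => [[f]|[y]]; rewrite !inE => h ->.
  have /edgesP[a [b [ab E]]] := valP f.
  move: h; rewrite E !inE => /orP[]/eqP->; first by exists b; rewrite ?inE.
  by exists a; rewrite ?inE 1?adj_sym // setUC.
by exists (Sub [set x; y] (edge_xy _ h)); rewrite ?inE ?SubK ?eqxx.
Qed.

(** The stars of [x] and [y] together consist of [e] and its neighbours in L(G), and they meet only
    in [e] because G is simple. *)
Lemma line_degreeD2 (e : L) x y : adj x y -> val e = [set x; y] ->
  (degree e).+2 = (degree x + degree y)%N.
Proof.
move=> xy E; rewrite -!card_incident -cardsUI.
have -> : incident x :&: incident y = [set e].
  apply/setP => f; rewrite !inE -val_eqE E.
  apply/andP/eqP => [|->]; last by rewrite set21 set22.
  have /edgesP[a [b [_ ->]]] := valP f; rewrite !inE.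
  case=> /orP[]/eqP xa /orP[]/eqP yb; move: (adj_neq xy);
    by rewrite xa yb ?eqxx // setUC.
rewrite cards1 addn1; congr _.+1.
rewrite (cardsD1 e) !inE E set21 /= add1n; congr _.+1.
apply: eq_card => f; rewrite !inE /= /line_adj eq_sym; congr (_ && _).
rewrite E; apply/set0Pn/orP => [[z]|].
  by rewrite !inE => /andP[/orP[]/eqP-> ->]; [left|right].
by case=> h; [exists x|exists y]; rewrite !inE eqxx ?orbT h.
Qed.

Lemma incident_adj x (e f : L) :
  x \in val e -> x \in val f -> e != f -> adj e f.
Proof.
move=> xe xf ef; rewrite /adj /= /line_adj ef.
by apply/set0Pn; exists x; rewrite inE xe.
Qed.

Lemma degree_incident x (e : L) : x \in val e -> (degree x <= (degree e).+1)%N.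
Proof.
move=> xe; rewrite -card_incident (cardsD1 e) inE xe add1n ltnS.
apply: subset_leq_card; apply/subsetP => f; rewrite !inE => /andP[fe xf].
by apply: incident_adj xe xf _; rewrite eq_sym.
Qed.

(** Otherwise both ends of [e] have degree 1, so [[set x; y]] contains the component of [x], which
    then has at most one edge. *)
Lemma line_degree_gt0 (e : L) : nontrivial G -> (0 < degree e)%N.
Proof.
move=> nt; have /edgesP[x [y [xy E]]] := valP e.
rewrite lt0n; apply/eqP => e0; have := nt x; rewrite leqNgt => /negP; apply.
have D := line_degreeD2 xy E; rewrite e0 in D.
have dx := degree_gt0 xy; have dy : (0 < degree y)%N.
  by apply: (@degree_gt0 _ _ x); rewrite adj_sym.
have only (u v w : G) : adj u v -> degree u = 1%N -> adj u w -> w = v.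
  move=> uv /eqP/cards1P[t T] uw.
  have : w \in [set t] by rewrite -T inE.
  have : v \in [set t] by rewrite -T inE.
  by rewrite !inE => /eqP-> /eqP->.
have dx1 : degree x = 1%N by lia.
have dy1 : degree y = 1%N by lia.
have cl : closed (@adj G) [set x; y].
  apply: intro_closed => [|a b]; first by apply: sym_connect_sym; exact: adj_sym.
  move=> ab; rewrite !inE => /orP[]/eqP ea; rewrite ea in ab.
    by rewrite (only _ _ _ xy dx1 ab) eqxx orbT.
  by rewrite adj_sym in xy; rewrite (only _ _ _ xy dy1 ab) eqxx.
have comp z : z \in component x -> z \in [set x; y].
  by rewrite inE => /(closed_connect cl) <-; rewrite set21.
rewrite ltnS; apply: (@leq_trans #|[set [set x; y]]|); last by rewrite cards1.
apply: subset_leq_card; apply/subsetP => f.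
rewrite inE => /andP[/edgesP[a [b [ab ->]]]].
rewrite subUset !sub1set => /andP[/comp + /comp].
rewrite !inE set2_eqE // !xpair_eqE.
have := adj_neq ab.
by move=> ne /orP[]/eqP ea /orP[]/eqP eb; move: ne;
  rewrite ea eb !eqxx //= orbT.
Qed.

End LineDegree.

(** * The charging argument *)

Section Charging.
Set Implicit Arguments.
Unset Strict Implicit.
Variables (R : rcfType) (k : R).
Hypotheses (k_ge0 : 0 <= k) (k_le : k <= 3 / 8 * Num.sqrt 2).

(* What an L(G)-vertex of degree [p] gets from its edge to one of degree [q]. *)
Definition share (p q : nat) : R :=
  if p == 1%N then if (q <= 2)%N then 1 / 2 else k
  else if (q == 1%N) && (2 < p)%N then 0 else k / 2.

Lemma share_ge0 p q : 0 <= share p q.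
Proof. by have k0 := k_ge0; rewrite /share; do !case: ifP => _; lra. Qed.

(** Up to symmetry, degrees (1, 1) ask for 1/2 + 1/2 = 1, degrees (1, 2) for 1/2 + [k / 2], and all
    others for [k] in total. *)
Lemma shareD p q : (0 < p)%N -> (0 < q)%N -> k <= ga R p q ->
  share p q + share q p <= ga R p q.
Proof.
have r := sqrt2_gt R; have k' := k_le.
have s12 : 1 / 2 + k / 2 <= ga R 1 2 by rewrite ga12; lra.
rewrite /share.
case: p q => [|[|[|p]]] [|[|[|q]]] //= _ _ kga; rewrite ?addr0 ?add0r; try lra.
  by rewrite ga11; lra.
by rewrite addrC gaC.
Qed.

Variable G : sgraph.
Local Notation L := (line_graph G).

Lemma share_edge (e : L) :
  (0 < degree e)%N ->
  k * ga_edge R (val e) <= \sum_(f : L | adj e f) share (degree e) (degree f).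
Proof.
have k0 := k_ge0; have r1 := sqrt2_gt R; have r2 := sqrt2_lt R; have k' := k_le.
have /edgesP[x [y [xy E]]] := valP e; rewrite E ga_edge_set2 //.
have D := line_degreeD2 xy E; move=> e0.
have dx := degree_gt0 xy.
have dy : (0 < degree y)%N by apply: (@degree_gt0 _ _ x); rewrite adj_sym.
have kga : k * ga R (degree x) (degree y) <= k.
  by rewrite ler_piMr // ga_le1.
(* Shares are nonnegative, so any set [A] of neighbours gives a lower bound. *)
have sum_ge (A : {set L}) (c : R) : A \subset [set f | adj e f] ->
    (forall f, f \in A -> c <= share (degree e) (degree f)) ->
    c *+ #|A| <= \sum_(f : L | adj e f) share (degree e) (degree f).
  move=> /subsetP sA cA; rewrite -sumr_const.
  rewrite [leRHS](bigID (mem A)) /= ler_wpDr ?sumr_ge0 // => [f _|].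
    exact: share_ge0.
  rewrite [leRHS](eq_bigl (mem A)) ?ler_sum // => f /=.
  by rewrite andbC; case: (boolP (f \in A)) => // /sA; rewrite inE.
have [e1|e_neq1] := eqVneq (degree e) 1%N.
  have gaE : ga R (degree x) (degree y) = 2 * Num.sqrt 2 / 3.
    have [[-> ->]|[-> ->]] : degree x = 1%N /\ degree y = 2 \/
      degree x = 2 /\ degree y = 1%N by lia.
      exact: ga12.
    by rewrite gaC ga12.
  rewrite -[leLHS]mulr1n -[in leLHS]e1; apply: sum_ge => // f _.
  rewrite /share e1 eqxx; case: ifP => // _; rewrite gaE.
  have rr : Num.sqrt 2 * Num.sqrt 2 = 2 :> R by rewrite -expr2 sqr_sqrtr ?ler0n.
  (* Source of the constant 3 / (4 sqrt 2): it makes [k] times the weight 2 sqrt 2 / 3 at most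
     1/2. *)
  have : k * Num.sqrt 2 <= 3 / 8 * Num.sqrt 2 * Num.sqrt 2.
    by rewrite ler_wpM2r ?sqrtr_ge0.
  lra.
apply: le_trans kga _.
have k2 : k = (k / 2) *+ 2 by lra.
(* A vertex of degree 2 gets [k / 2] from each neighbour, even from one of degree 1. *)
have [e2|e_neq2] := eqVneq (degree e) 2%N.
  rewrite [leLHS]k2 -[in leLHS]e2; apply: sum_ge => // f _.
  by rewrite /share e2 /= andbF.
(* The end degrees of [e] now sum to at least 5. *)
have [z [ze dz]] : exists z, z \in val e /\ (2 < degree z)%N.
  rewrite E; case: (ltnP 2 (degree x)) => dx2; [exists x|exists y];
    rewrite !inE eqxx ?orbT; split=> //; lia.
have cA : (2 <= #|incident z :\ e|)%N.
  by have := cardsD1 e (incident z); rewrite card_incident inE ze; lia.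
apply: (@le_trans _ _ ((k / 2) *+ #|incident z :\ e|)).
  by rewrite [leLHS]k2 ler_wpMn2l //; lra.
apply: sum_ge => [|f].
  apply/subsetP => f; rewrite !inE => /andP[fe zf].
  by apply: incident_adj ze zf _; rewrite eq_sym.
(* Edges at [z] have degree at least [degree z - 1 >= 2] in L(G), so [f] pays [k / 2]. *)
rewrite !inE => /andP[_ /degree_incident zf].
by rewrite /share (negPf e_neq1) (_ : degree f == 1%N = false) //; lia.
Qed.

(** Twice [GA1 R L] is a sum over ordered pairs; [shareD] bounds each term below by two shares, and
    [share_edge] bounds the shares collected by each vertex. *)
Lemma GA1_line_ge :
  (forall e f : L, adj e f -> k <= ga R (degree e) (degree f)) ->
  (forall e : L, 0 < degree e)%N ->
  k * GA1 R G <= GA1 R L.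
Proof.
move=> kga dL.
have -> : GA1 R G = \sum_(e : L) ga_edge R (val e).
  exact: (big_sub (edges G) (@ga_edge R G)).
rewrite -(@ler_pMn2r _ 2) // GA1_sum_adj.
apply: (@le_trans _ _ (\sum_(e : L) \sum_(f | adj e f)
    (share (degree e) (degree f) + share (degree f) (degree e)))).
  rewrite sum_adj_symmetrize ler_wMn2r // mulr_sumr ler_sum // => e _.
  exact: share_edge.
apply: ler_sum => e _; apply: ler_sum => f ef.
exact: shareD (dL _) (dL _) (kga _ _ ef).
Qed.

End Charging.

(** * The range of degrees in L(G) *)

Section LineBound.
Set Implicit Arguments.
Unset Strict Implicit.
Variables (R : rcfType) (G : sgraph).
Hypothesis nt : nontrivial G.

(** [degree e + 2] is the sum of two degrees of G; the 1 in the maximum comes from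
    non-triviality. *)
Lemma line_degree_bounds (e : line_graph G) :
  Num.max (2 * (min_degree G)%:R - 2 : R) 1 <= ((degree e)%:R : R)
    <= 2 * (max_degree G)%:R - 2.
Proof.
have /edgesP[x [y [xy E]]] := valP e.
have D := congr1 (fun n => n%:R : R) (line_degreeD2 xy E).
rewrite /= -addn2 !natrD in D.
have le (m n : nat) : (m <= n)%N -> m%:R <= n%:R :> R by rewrite ler_nat.
have := le _ _ (degree_le_max x); have := le _ _ (degree_le_max y).
have := le _ _ (min_degree_le x); have := le _ _ (min_degree_le y).
have := le _ _ (line_degree_gt0 e nt).
by move=> *; rewrite ge_max; apply/andP; split; [apply/andP; split|]; lra.
Qed.

Lemma line_bound_le (e f : line_graph G) :
  line_bound (max_degree G)%:R (min_degree G)%:R <= ga R (degree e) (degree f).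
Proof.
rewrite /line_bound ge_min; apply/orP; right.
apply: ga_ge (line_degree_bounds e) (line_degree_bounds f).
by rewrite lt_max ltr01 orbT.
Qed.

End LineBound.

(** * The path with three vertices *)

Lemma adj_path3 (i j : path_graph 3) :
  adj i j = (i.+1 == j :> nat) || (j.+1 == i :> nat).
Proof. by []. Qed.

Lemma degree_path3 (i : path_graph 3) :
  degree i = (if i == 1 :> nat then 2 else 1)%N.
Proof.
rewrite /degree -sum1dep_card big_mkcond !big_ord_recl big_ord0 !adj_path3.
by case: i => -[|[|[|]]].
Qed.

Lemma nontrivial_path3 : nontrivial (path_graph 3).
Proof.
pose m : path_graph 3 := @Ordinal 3 1 isT.
have conn (x y : path_graph 3) : connect (@adj (path_graph 3)) x y.
  have to_m (z : path_graph 3) : connect (@adj (path_graph 3)) z m.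
    have [->|zm] := eqVneq z m; first exact: connect0.
    apply: connect1; move: zm; rewrite adj_path3 -val_eqE.
    by case: z => -[|[|[|]]].
  apply: connect_trans (to_m x) _; rewrite sym_connect_sym //; exact: adj_sym.
move=> x; pose l : path_graph 3 := ord0; pose r : path_graph 3 := ord_max.
have ne : [set l; m] != [set m; r].
  by apply/eqP => /setP/(_ l); rewrite !inE.
apply: (@leq_trans #|[set [set l; m]; [set m; r]]|); first by rewrite cards2 ne.
apply/subset_leq_card/subsetP => e; rewrite !inE => eE; apply/andP; split.
  by apply/edgesP; case/orP: eE => /eqP->; [exists l, m|exists m, r].
by apply/subsetP => z _; rewrite inE.
Qed.

Lemma max_degree_path3 : max_degree (path_graph 3) = 2.
Proof.
rewrite /max_degree; under eq_bigr do rewrite degree_path3.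
by rewrite !big_ord_recl big_ord0.
Qed.

Lemma min_degree_path3 : min_degree (path_graph 3) = 1%N.
Proof.
rewrite /min_degree; under eq_bigr do rewrite degree_path3.
by rewrite !big_ord_recl big_ord0 card_ord.
Qed.

Lemma GA1_path3 (R : rcfType) : GA1 R (path_graph 3) = 4 / 3 * Num.sqrt 2.
Proof.
apply: (@pmulrnI _ 2) => //; rewrite GA1_sum_adj.
under eq_bigr do under eq_bigr do rewrite !degree_path3.
under eq_bigr do rewrite big_mkcond !big_ord_recl big_ord0 !adj_path3.
rewrite !big_ord_recl big_ord0 /= (gaC R 2 1) ga12; lra.
Qed.

Lemma GA1_line_path3 (R : rcfType) : GA1 R (line_graph (path_graph 3)) = 1.
Proof.
have d1 (e : line_graph (path_graph 3)) : degree e = 1%N.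
  have /edgesP[x [y [xy E]]] := valP e; have := line_degreeD2 xy E.
  move: xy; rewrite !degree_path3 adj_path3.
  by case: x {E} => -[|[|[|]]] //= _; case: y => -[|[|[|]]] //= _ _ [].
(* Handshake with constant weight 1: the degree sum 1 + 2 + 1 is twice the number of edges. *)
have cE : #|edges (path_graph 3)| = 2.
  have := @sum_edges (path_graph 3) nat (fun=> 1%N).
  under eq_bigr do rewrite sum1dep_card -/(degree _) degree_path3.
  by rewrite !big_ord_recl big_ord0 sum1_card /= -mulr_natr; lia.
have sum1 (e : line_graph (path_graph 3)) :
    \sum_(f | adj e f) ga R (degree e) (degree f) = 1.
  have <- : (degree e)%:R = 1 :> R by rewrite d1.
  rewrite [in RHS]/degree -sum1dep_card natr_sum.
  by apply: eq_bigr => f _; rewrite !d1 ga11.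
apply: (@pmulrnI _ 2) => //; rewrite GA1_sum_adj.
under eq_bigr do rewrite sum1.
by rewrite sumr_const (_ : #|_| = 2%N) // -[RHS]cE; exact: card_sig.
Qed.

Theorem theorem3p7 (R : rcfType) :
  (forall G : sgraph, nontrivial G ->
     GA1 R (line_graph G) >=
       line_bound (max_degree G)%:R (min_degree G)%:R * GA1 R G)
  /\
  (let P3 := path_graph 3 in
   nontrivial P3 /\
   GA1 R (line_graph P3) =
     line_bound (max_degree P3)%:R (min_degree P3)%:R * GA1 R P3).
Proof.
split=> [G nt|P3]; last first.
  split; first exact: nontrivial_path3.
  rewrite GA1_line_path3 GA1_path3 max_degree_path3 min_degree_path3.
  have r1 := sqrt2_gt R.
  rewrite /line_bound sqrt2_inv mulr1 subrr.
  have -> : 2 * 2 - 2 = 2 :> R by lra.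
  have -> : Num.max 0 1 = 1 :> R by apply/max_idPr; lra.
  have -> : 2 + 1 = 3 :> R by lra.
  (* The other term is 2 sqrt 2 / 3, which is larger; then (3/8 sqrt 2)(4/3 sqrt 2) = 1. *)
  rewrite mulr1 min_l; last by lra.
  have rr : Num.sqrt 2 * Num.sqrt 2 = 2 :> R by rewrite -expr2 sqr_sqrtr ?ler0n.
  lra.
(* Without edges [GA1 R G] is 0; otherwise an edge [e] witnesses [0 < b <= a], so the constant is
   nonnegative. *)
have [E|/set0Pn[e eG]] := eqVneq (edges G) set0.
  rewrite [GA1 R G]/GA1 E big_set0 mulr0; apply: sumr_ge0 => e _.
  by rewrite divr_ge0 ?sumr_ge0 // ?mulr_ge0 ?sqrtr_ge0.
apply: GA1_line_ge => [||e' f _|e'].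
- have /andP[b_le a_ge] := line_degree_bounds R nt (exist _ e eG).
  have b0 : 0 < Num.max (2 * (min_degree G)%:R - 2) 1 :> R.
    by rewrite lt_max ltr01 orbT.
  have a0 := lt_le_trans b0 (le_trans b_le a_ge).
  rewrite /line_bound le_min !divr_ge0 ?mulr_ge0 ?sqrtr_ge0 //.
  by rewrite addr_ge0 // ltW.
- by rewrite -sqrt2_inv /line_bound ge_min lexx.
- exact: (line_bound_le _ nt).
- exact: line_degree_gt0.
Qed.
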